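(* The modified adaptive fast multipole method has $\mathcal{O}(N)$ operation count for arbitrary particle distributions. Precisely: for every integer threshold $t\ge 1$ and every $\kappa>0$ there is a constant $c=c(t,\kappa)$ such that, for every $N\ge 1$ and every configuration of $N$ particles in $[0,1]^3$ whose adaptive octree $T$ with subdividing threshold $t$ is finite, the total cost of the modified adaptive FMM on $T$ (the sum of the costs of all its P2M, M2M, M2L, P2L, L2L, M2P, P2P and L2P operations, each single operation costing at most $\kappa$) is at most $cN$. The constant $c$ does not depend on the particle positions or on the depth of $T$.
   Context: **Adaptive octree.** Let $x_1,\dots,x_N\in[0,1]^3$ be particles (sources and observation points coincide). The root corresponds to the closed cube $[0,1]^3$ and has depth $0$. A node containing more than $t$ particles is subdivided into its $8$ congruent closed sub-cubes; only children containing particles are kept as nodes of the tree. A node with at most $t$ particles is a leaf. A particle lying on a dividing midplane is assigned to the left (lower-coordinate) child, so each particle in a node belongs to exactly one of its children. The resulting tree $T$ is assumed finite (this is automatic if the particles are distinct). $\mathcal{I}(M)$ is the closed cube of node $M$, $\delta(M)$ its depth, $\mathcal{P}(M)$ its parent. **Relations.** Nodes $A,B$ are adjacent if $\mathcal{I}(A)\cap\mathcal{I}(B)\neq\emptyset$. Colleagues are adjacent nodes of the same depth. The vicinity $\mathcal{V}(C)$ is the union of the $26$ cubes of the same size as $\mathcal{I}(C)$ in the same grid that touch $\mathcal{I}(C)$ and differ from it (whether or not they are nodes). A node $\alpha$ is separated from $C$ if the interior of $\mathcal{I}(\alpha)$ meets the interior of $\mathcal{V}(\mathcal{P}(C))$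 and does not meet the interior of $\mathcal{V}(C)$. A node $\alpha$ is well-separated from $C$ if it is separated from $C$ and $\delta(\alpha)\le\delta(C)$. (Nothing is separated from the root.) **Lists.** - U-List$(C)$ ($C$ a leaf): all leaves $\alpha$ adjacent to $C$, including $C$ itself. - V-List$(C)$: all nodes $\alpha$ such that $\alpha$ and $C$ are well-separated from each other. - W-List$(C)$ ($C$ a leaf): all $\alpha$ such that $C$ is well-separated from $\alpha$ but $\alpha$ is not well-separated from $C$. - X-List$(C)$: all $\alpha$ with $C\in$ W-List$(\alpha)$. **Divided and singleton nodes.** A node is occupied if it contains a particle. A divided node is an occupied node with at least two occupied children. A singleton node is an occupied node with exactly one occupied child. Leaves are neither. The divided parent of a non-root node is its deepest proper ancestor that is a divided node or the root. The divided children of a divided node $\nu$ are the proper descendants $\beta$ of $\nu$ that are divided nodes or occupied leaves and such that no node strictly between $\nu$ and $\beta$ is divided. **Operations of the modified adaptive FMM.** - P2M and L2P: one of each per particle (in the leaf containing it). - M2M: one for each pair (non-root occupied non-singleton node, its divided parent); multipole coefficients are passed directly, skipping singleton nodes. - L2L: one for each pair (divided node, one of its divided children). - M2L: one for each ordered pair $(C,\alpha)$ with $\alpha\in$ V-List$(C)$. (For singleton nodes, which carry no coefficients in the modified algorithm, these operations are handled by their divided children; their number is unchanged.) - M2P: one for each pair $(C,\alpha)$ with $C$ a leaf and $\alpha\in$ W-List$(C)$. - P2L: one for each pair $(C,\alpha)$ with $\alpha\in$ X-List$(C)$. - P2P: one for each ordered pair of particles $(x,y)$, with $x$ in a leaf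 $C$ and $y$ in a leaf of U-List$(C)$. The rank $r$ of all low-rank approximations is constant, independent of node depth, so the cost of a single operation is bounded by a constant $\kappa$ depending only on $t$, $r$ and the cost of one kernel evaluation. The cost of building the tree is not counted. *)

(* Defs.v *)
From HB Require Import structures.
From mathcomp Require Import all_boot all_order all_algebra.
From mathcomp Require Import boolp classical_sets functions cardinality fsbigop.
From mathcomp Require Import reals topology normedtype.

Set Implicit Arguments.
Unset Strict Implicit.
Unset Printing Implicit Defensive.

Import Order.TTheory GRing.Theory Num.Theory.
Import numFieldNormedType.Exports.

Local Open Scope classical_set_scope.
Local Open Scope ring_scope.

(* [o j] tells whether the child is the right (higher-coordinate) one along
   coordinate [j]. *)
Definition octant : Type := {ffun 'I_3 -> bool}.

(* A cube obtained from the root cube [0,1]^3 by repeated subdivision is named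
   by its octants, the most recent one first: the root is [[::]], the children
   of [M] are the [o :: M], the parent of [o :: M] is [M], the depth is [size],
   and the ancestors of [M] are its suffixes. *)
Definition node : Type := seq octant.

Definition proper_ancestor (A M : node) : bool := suffix A M && (A != M).

(* The node [M] is the cube number [grid_index M] of the grid of mesh
   2^-(size M). *)
Fixpoint grid_index (M : node) : 'rV[int]_3 :=
  if M is o :: P then \row_j (2 * grid_index P 0 j + (o j)%:R) else 0.

Section Geometry.
Variable R : realType.

Definition grid_cube (d : nat) (k : 'rV[int]_3) : set 'rV[R]_3 :=
  [set y | forall j, (k 0 j)%:~R / 2 ^+ d <= y 0 j <= (k 0 j + 1)%:~R / 2 ^+ d].

Definition cell (M : node) : set 'rV[R]_3 := grid_cube (size M) (grid_index M).

Definition midplane (M : node) (j : 'I_3) : R :=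
  (2 * grid_index M 0 j + 1)%:~R / 2 ^+ (size M).+1.

Definition adjacent (A B : node) : Prop := cell A `&` cell B !=set0.

(* The grid is the infinite one: the cubes need not lie in [0,1]^3. *)
Definition vicinity (C : node) : set 'rV[R]_3 :=
  \bigcup_(k in [set k | grid_cube (size C) k `&` cell C !=set0 /\
                         grid_cube (size C) k <> cell C])
    grid_cube (size C) k.

(* [separated A C]: A is separated from C. *)
Definition separated (A C : node) : Prop :=
  if C is _ :: P then
    interior (cell A) `&` interior (vicinity P) !=set0 /\
    ~ (interior (cell A) `&` interior (vicinity C) !=set0)
  else False.

Definition well_separated (A C : node) : Prop :=
  separated A C /\ (size A <= size C)%N.

End Geometry.

(* [M2M C D] goes from C to D, [L2L D C] from D to C; in [M2L C A], [M2P C A]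
   and [P2L C A], the node A is in the V-, W- and X-list of C respectively. *)
Inductive operation (N : nat) : Type :=
| P2M of 'I_N
| L2P of 'I_N
| M2M of node & node
| L2L of node & node
| M2L of node & node
| M2P of node & node
| P2L of node & node
| P2P of 'I_N & 'I_N.

HB.instance Definition _ (N : nat) := gen_eqMixin (operation N).
HB.instance Definition _ (N : nat) := gen_choiceMixin (operation N).

Section Octree.
Variables (R : realType) (t N : nat) (x : 'I_N -> 'rV[R]_3).

(* Particle [i] is assigned to [M]; on a midplane, the left child gets it.
   The root gets all particles, which are assumed to lie in [0,1]^3. *)
Fixpoint contains (M : node) (i : 'I_N) : bool :=
  if M is o :: P then
    contains P i && [forall j, o j == (midplane R P j < x i 0 j)]
  else true.

Definition nb_particles (M : node) : nat := #|[pred i | contains M i]|.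

Definition occupied (M : node) : bool := (0 < nb_particles M)%N.

Fixpoint is_node (M : node) : bool :=
  if M is o :: P then
    [&& is_node P, (t < nb_particles P)%N & occupied (o :: P)]
  else true.

Definition octree : set node := [set M | is_node M].

Definition leaf (M : node) : bool := is_node M && (nb_particles M <= t)%N.

Definition occupied_children (M : node) : pred octant :=
  [pred o | is_node (o :: M) && occupied (o :: M)].

Definition divided (M : node) : bool :=
  [&& is_node M, occupied M & (2 <= #|occupied_children M|)%N].

Definition singleton (M : node) : bool :=
  [&& is_node M, occupied M & #|occupied_children M| == 1%N].

Definition divided_parent (C D : node) : Prop :=
  [/\ proper_ancestor D C, divided D || (D == [::])
    & forall E, proper_ancestor E C -> divided E || (E == [::]) ->
        (size E <= size D)%N].

Definition divided_child (D B : node) : Prop :=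
  [/\ divided D, proper_ancestor D B, divided B || (leaf B && occupied B)
    & forall E, proper_ancestor D E -> proper_ancestor E B -> ~~ divided E].

Definition U_list (C : node) : set node :=
  [set A | [/\ leaf C, leaf A & adjacent R A C]].

Definition V_list (C : node) : set node :=
  [set A | [/\ is_node C, is_node A,
               well_separated R A C & well_separated R C A]].

Definition W_list (C : node) : set node :=
  [set A | [/\ leaf C, is_node A,
               well_separated R C A & ~ well_separated R A C]].

Definition X_list (C : node) : set node :=
  [set A | is_node C /\ W_list A C].

Definition performed : set (operation N) :=
  [set op | match op with
    | P2M _ => True
    | L2P _ => True
    | M2M C D => [/\ is_node C, C != [::], occupied C, ~~ singleton C
                   & divided_parent C D]
    | L2L D C => divided_child D C
    | M2L C A => V_list C A
    | M2P C A => W_list C A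
    | P2L C A => X_list C A
    | P2P i j => exists C A, [/\ leaf C, contains C i, U_list C A
                               & contains A j]
    end].

(* This sum has finite support as soon as the octree is finite, see
   [finite_performed]. *)
Definition total_cost (cost : operation N -> R) : R :=
  \sum_(op \in performed) cost op.

Lemma proper_ancestor_node (A M : node) :
  proper_ancestor A M -> is_node M -> is_node A.
Proof.
rewrite /proper_ancestor => /andP[/suffixP[s ->] _].
by elim: s => //= o s IHs /and3P[/IHs].
Qed.

Lemma finite_performed : finite_set octree -> finite_set performed.
Proof.
move=> finT.
have leafT M : leaf M -> octree M by case/andP.
have divT M : divided M -> octree M by case/and3P.
pose P := octree `*` octree.
have finP (f : node * node -> operation N) : finite_set (f @` P).
  exact/finite_image/finite_setX.
apply: (@sub_finite_set _ _
  (range (@P2M N) `|` range (@L2P N)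
   `|` (range (fun p => P2P p.1 p.2)
   `|` ((fun p => M2M N p.1 p.2) @` P `|` (fun p => L2L N p.1 p.2) @` P
   `|` ((fun p => M2L N p.1 p.2) @` P `|` (fun p => M2P N p.1 p.2) @` P
   `|` (fun p => P2L N p.1 p.2) @` P))))); last first.
  by rewrite !finite_setU; do !split; try exact: finP;
    apply: finite_image; exact: finite_finset.
case=> [i|i|C D|D C|C A|C A|C A|i j] /=.
- by left; left; exists i.
- by left; right; exists i.
- case=> nC _ _ _ [aDC _ _]; right; right; left; left; exists (C, D) => //.
  by split=> //=; exact: proper_ancestor_node aDC nC.
- case=> /divT nD _ /orP[/divT nC|/andP[/leafT nC _]] _;
  by right; right; left; right; exists (D, C).
- by case=> nC nA _ _; right; right; right; left; left; exists (C, A).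
- by case=> /leafT nC nA _ _; right; right; right; left; right; exists (C, A).
- by case=> nC [/leafT nA _ _ _]; right; right; right; right; exists (C, A).
- by move=> _; right; left; exists (i, j).
Qed.

End Octree.

(* Main.v *)
(* Call two nodes touching when their closed cells meet. The V-list pairs are
   non-touching pairs of nodes of equal depth whose parents touch. The
   child pairs of touching pairs of equal depth are such pairs or touching
   pairs again, so, by telescoping over the depth, the number of V-list
   pairs is at most 1 plus the excess number of child pairs of touching
   pairs, and an excess occurs only where one of the two nodes is divided.
   A node touches at most 27 nodes of its depth, so there are O(#divided)
   V-list pairs, no matter how long the chains of singleton nodes are. The
   same telescoping, descending only below the neighbours of a leaf,
   bounds the W-list, using that a node touches at most 27 leaves that are
   not deeper. Finally there are at most N leaves, and no more divided
   nodes than leaves. *)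
Require Import Defs.
From mathcomp Require Import all_boot all_order all_algebra.
From mathcomp Require Import boolp classical_sets functions cardinality fsbigop.
From mathcomp Require Import reals topology normedtype.
From mathcomp Require Import zify lra.

Set Implicit Arguments.
Unset Strict Implicit.
Unset Printing Implicit Defensive.

Import Order.TTheory GRing.Theory Num.Theory.
Import numFieldNormedType.Exports.

Local Open Scope classical_set_scope.
Local Open Scope ring_scope.

(** * Double counting along the fibres of a map *)

Lemma sum_pred_count (I : Type) (P : pred I) (s : seq I) :
  (\sum_(a <- s) P a)%N = count P s.
Proof.
by rewrite -sum1_count [RHS]big_mkcond; apply: eq_bigr => a _; case: (P a).
Qed.

(** After exchanging the sums, each [a] is counted at least once, namely at [f a]. *)
Lemma size_le_sum_fibers (I J : eqType) (f : I -> J) (s : seq I) (D : seq J) :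
  {in s, forall a, f a \in D} ->
  (size s <= \sum_(b <- D) count (fun a => f a == b) s)%N.
Proof.
move=> fD; under eq_bigr do rewrite -sum1_count big_mkcond.
rewrite exchange_big /= -sum1_size big_seq [leqRHS]big_seq.
apply: leq_sum => a /fD aD; rewrite -big_mkcond sum1_count.
by rewrite -has_count; apply/hasP; exists (f a) => /=.
Qed.

Lemma size_le_mul_fibers (I J : eqType) (f : I -> J) (s : seq I) (D : seq J)
    (m : nat) :
  {in s, forall a, f a \in D} ->
  {in D, forall b, count (fun a => f a == b) s <= m}%N ->
  (size s <= m * size D)%N.
Proof.
move=> fD fm; apply: leq_trans (size_le_sum_fibers fD) _.
rewrite -iter_addn_0 -count_predT -big_const_seq big_seq [leqRHS]big_seq.
exact: leq_sum.
Qed.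

(* [E] is a forest with roots [E0] and parent map [p], and [V] consists of
   further children of elements of [E]: counting the elements of [E1] both as
   children and as parents leaves only the excess branching [w]. *)
Lemma size_boundary (I : eqType) (p : I -> I) (w : I -> nat)
    (E0 E1 V : seq I) :
  {in V ++ E1, forall a, p a \in E0 ++ E1} ->
  {in E0 ++ E1, forall b, count (fun a => p a == b) (V ++ E1) <= (w b).+1}%N ->
  (size V <= size E0 + \sum_(b <- E0 ++ E1) w b)%N.
Proof.
move=> pE fw; rewrite -(leq_add2r (size E1)) addnAC -!size_cat.
apply: leq_trans (size_le_sum_fibers pE) _.
rewrite -sum1_size -big_split /= big_seq [leqRHS]big_seq.
exact: leq_sum.
Qed.

(** * Integer geometry of the subdivision grids *)

(* For [size M <= d]: the cube [k] of the grid of mesh 2^-d lies in the cell of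
   [M]. *)
Definition covers (M : node) (d : nat) (k : 'rV[int]_3) : bool :=
  [forall j, (grid_index M 0 j * 2 ^+ d <= k 0 j * 2 ^+ size M) &&
             (k 0 j * 2 ^+ size M < (grid_index M 0 j + 1) * 2 ^+ d)].

(* The closed cells of [A] and [B] meet. *)
Definition touch (A B : node) : bool :=
  [forall j, (grid_index A 0 j * 2 ^+ size B <=
                (grid_index B 0 j + 1) * 2 ^+ size A) &&
             (grid_index B 0 j * 2 ^+ size A <=
                (grid_index A 0 j + 1) * 2 ^+ size B)].

Lemma touch_sym (A B : node) : touch A B = touch B A.
Proof. by apply: eq_forallb => j; rewrite andbC. Qed.

Lemma exp2z_gt0 (d : nat) : 0 < 2 ^+ d :> int.
Proof. exact: exprn_gt0. Qed.

Lemma grid_index_cons (o : octant) (M : node) (j : 'I_3) :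
  grid_index (o :: M) 0 j = 2 * grid_index M 0 j + (o j)%:R.
Proof. by rewrite mxE. Qed.

Lemma touch_behead (A : node) (o : octant) (B : node) :
  touch A (o :: B) -> touch A B.
Proof.
move=> /forallP tAB; apply/forallP => j; move: (tAB j).
rewrite grid_index_cons /= exprS.
move: (grid_index A 0 j) (grid_index B 0 j) => a b.
move: (exp2z_gt0 (size A)) (exp2z_gt0 (size B)).
move: (2 ^+ size A) (2 ^+ size B) => p q p0 q0.
by case: (o j) => /andP[]; rewrite ?mulr1n ?mulr0n => *; apply/andP; split; lia.
Qed.

Lemma covers_behead (o : octant) (M : node) (d : nat) (k : 'rV[int]_3) :
  covers (o :: M) d k -> covers M d k.
Proof.
move=> /forallP cM; apply/forallP => j; move: (cM j).
rewrite grid_index_cons /= exprS.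
move: (grid_index M 0 j) (k 0 j) => a b.
move: (exp2z_gt0 (size M)) (exp2z_gt0 d).
move: (2 ^+ size M) (2 ^+ d) => p q p0 q0.
by case: (o j) => /andP[]; rewrite ?mulr1n ?mulr0n => *; apply/andP; split; lia.
Qed.

(** The bounds in [covers] are half-open, so the cells of one depth partition the finer cubes. By
    induction the parents agree, and then each octant bit is forced. *)
Lemma covers_inj (A B : node) (d : nat) (k : 'rV[int]_3) :
  size A = size B -> covers A d k -> covers B d k -> A = B.
Proof.
elim: A B => [|o A IHA] [|o' B] //= [sAB] cA cB.
have AB := IHA _ sAB (covers_behead cA) (covers_behead cB); subst B.
congr (_ :: _); apply/ffunP => j.
move/forallP: cA => /(_ j); move/forallP: cB => /(_ j).
rewrite !grid_index_cons /=.
move: (grid_index A 0 j) (k 0 j) (2 ^+ (size A).+1) (exp2z_gt0 d) => a b p.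
move: (2 ^+ d) => q q0.
by case: (o j) (o' j) => [] [] //= /andP[h1 h2] /andP[h3 h4]; exfalso; nia.
Qed.

Lemma covers_suffix (A B : node) (d : nat) (k : 'rV[int]_3) :
  (size A <= size B)%N -> covers A d k -> covers B d k -> suffix A B.
Proof.
elim: B => [|o B IHB]; first by rewrite leqn0 size_eq0 => /eqP->.
rewrite leq_eqVlt => /orP[/eqP sAB cA cB|].
  by rewrite (covers_inj sAB cA cB) suffix_refl.
rewrite ltnS => sAB cA /covers_behead cB.
by apply: suffix_trans (IHB sAB cA cB) _; apply/suffixP; exists [:: o].
Qed.

Lemma covers_grid_index (M : node) : covers M (size M) (grid_index M).
Proof.
by apply/forallP => j; rewrite lexx ltr_pM2r ?exp2z_gt0 // ltzD1 lexx.
Qed.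

Lemma covers_eq (M : node) (k : 'rV[int]_3) :
  covers M (size M) k -> k = grid_index M.
Proof.
move=> /forallP cM; apply/rowP => j; have := cM j.
rewrite ler_pM2r ?exp2z_gt0 // ltr_pM2r ?exp2z_gt0 //.
by move=> /andP[]; lia.
Qed.

(* Moving from the cube of [B] by [clamp_offset A B] brings it inside [A]. *)
Definition clamp_offset (A B : node) : {ffun 'I_3 -> 'I_3} :=
  [ffun j => if grid_index B 0 j * 2 ^+ size A <
                  grid_index A 0 j * 2 ^+ size B then inord 2
             else if (grid_index A 0 j + 1) * 2 ^+ size B <=
                  grid_index B 0 j * 2 ^+ size A then inord 0
             else inord 1].

(** The values 0, 1, 2 of [f] encode the displacements -1, 0, 1. *)
Definition grid_shift (f : {ffun 'I_3 -> 'I_3}) (B : node) : 'rV[int]_3 :=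
  \row_j (grid_index B 0 j + (f j)%:Z - 1).

(** The cube of [B] is no larger than that of [A] and touches it, so in each coordinate it is at
    most one step outside [A]. *)
Lemma covers_clamp (A B : node) : (size A <= size B)%N -> touch A B ->
  covers A (size B) (grid_shift (clamp_offset A B) B).
Proof.
move=> sAB /forallP tAB; apply/forallP => j; move: (tAB j); rewrite !mxE ffunE.
rewrite -(subnK sAB) exprD.
move: (grid_index A 0 j) (grid_index B 0 j) => a b.
move: (exp2z_gt0 (size A)) (exp2z_gt0 (size B - size A)).
move: (2 ^+ size A) (2 ^+ (size B - size A)) => p q p0 q0.
rewrite !mulrA !ler_pM2r // !ltr_pM2r //.
by case: ifPn => [|?]; [|case: ifPn];
  rewrite inordK // => *; apply/andP; split; lia.
Qed.

(** There are 27 = 3^3 clamp offsets. Two nodes with the same offset both cover the same cube of the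
    grid of [B], so one is an ancestor of the other and the antichain hypothesis makes them
    equal. *)
Lemma size_touching_antichain (B : node) (s : seq node) : uniq s ->
  {in s, forall A, (size A <= size B)%N && touch A B} ->
  {in s &, forall A C, suffix A C -> A = C} ->
  (size s <= 27)%N.
Proof.
move=> us sB santi; rewrite -(size_map (clamp_offset ^~ B)).
have -> : 27%N = size (enum {ffun 'I_3 -> 'I_3}).
  by rewrite -cardE card_ffun !card_ord.
apply: uniq_leq_size => [|f _]; last by rewrite mem_enum.
rewrite map_inj_in_uniq // => A C As Cs AC.
have /andP[sA tA] := sB _ As; have /andP[sC tC] := sB _ Cs.
have cA := covers_clamp sA tA; have cC := covers_clamp sC tC.
rewrite AC in cA.
have [sAC|/ltnW sCA] := leqP (size A) (size C).
  exact: santi As Cs (covers_suffix sAC cA cC).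
exact/esym/(santi _ _ Cs As)/(covers_suffix sCA cC cA).
Qed.

(** * From real cells and vicinities to integer inequalities *)

Section Geometry.
Variable R : realType.

Lemma exp2_gt0 (d : nat) : 0 < 2 ^+ d :> R.
Proof. exact: exprn_gt0. Qed.

(** Cross-multiplication turns comparisons of dyadic reals into integer inequalities. *)
Lemma le_grid (a b : int) (d e : nat) :
  (a%:~R / 2 ^+ d <= b%:~R / 2 ^+ e :> R) = (a * 2 ^+ e <= b * 2 ^+ d).
Proof.
rewrite ler_pdivrMr ?exp2_gt0 // mulrAC ler_pdivlMr ?exp2_gt0 //.
by rewrite -[2 in LHS]/(2%:~R) -!rmorphXn -!rmorphM ler_int.
Qed.

Lemma lt_grid (a b : int) (d e : nat) :
  (a%:~R / 2 ^+ d < b%:~R / 2 ^+ e :> R) = (a * 2 ^+ e < b * 2 ^+ d).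
Proof. by rewrite !ltNge le_grid. Qed.

Lemma adjacent_touch (A B : node) : adjacent R A B -> touch A B.
Proof.
move=> [y [yA yB]]; apply/forallP => j.
have /andP[A1 A2] := yA j; have /andP[B1 B2] := yB j.
by rewrite -!le_grid (le_trans A1 B2) (le_trans B1 A2).
Qed.

Lemma grid_cubes_meet (d : nat) (k l : 'rV[int]_3) :
  (forall j, k 0 j <= l 0 j + 1 /\ l 0 j <= k 0 j + 1) ->
  @grid_cube R d k `&` @grid_cube R d l !=set0.
Proof.
(* In each coordinate, the larger of the two lower ends lies in both intervals. *)
move=> kl; exists (\row_j ((Num.max (k 0 j) (l 0 j))%:~R / 2 ^+ d)).
by split=> j; rewrite mxE !le_grid !ler_pM2r ?exp2z_gt0 //; have := kl j; lia.
Qed.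

Lemma grid_cubes_meetP (d : nat) (k l : 'rV[int]_3) :
  @grid_cube R d k `&` @grid_cube R d l !=set0 ->
  forall j, k 0 j <= l 0 j + 1 /\ l 0 j <= k 0 j + 1.
Proof.
move=> [y [yk yl]] j; have /andP[k1 k2] := yk j; have /andP[l1 l2] := yl j.
have := le_trans k1 l2; have := le_trans l1 k2.
by rewrite !le_grid !ler_pM2r ?exp2z_gt0.
Qed.

Lemma interior_grid_cube (d : nat) (k : 'rV[int]_3) (y : 'rV[R]_3) :
  interior (@grid_cube R d k) y ->
  forall j, (k 0 j)%:~R / 2 ^+ d < y 0 j < (k 0 j + 1)%:~R / 2 ^+ d.
Proof.
move=> /nbhs_ballP[e /= e0 yk] j.
have e2 : 0 < e / 2 by rewrite divr_gt0.
(* Moving [y] by e/2 either way along the diagonal stays in the ball, which makes the bounds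
   strict. *)
have mem s : `|s| <= e / 2 -> grid_cube d k (y + const_mx s).
  move=> se; apply: yk; split=> // i i'.
  rewrite !mxE /ball /= opprD addNKr normrN.
  by apply: le_lt_trans se _; rewrite ltr_pdivrMr // ltr_pMr // ltr1n.
have := mem (e / 2); rewrite gtr0_norm // => /(_ (lexx _)) /(_ j).
have := mem (- (e / 2)); rewrite normrN gtr0_norm // => /(_ (lexx _)) /(_ j).
by rewrite !mxE => /andP[h1 _] /andP[_ h2]; apply/andP; split; lra.
Qed.

Lemma grid_cube_center (d : nat) (k : 'rV[int]_3) :
  interior (@grid_cube R d k) (\row_j ((2 * k 0 j + 1)%:~R / 2 ^+ d.+1)).
Proof.
apply/nbhs_ballP; exists (1 / 2 ^+ d.+1) => /=.
  by rewrite divr_gt0 ?exp2_gt0.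
move=> z [_ yz] j; have := yz 0 j; rewrite mxE /ball /= ltr_distl.
rewrite exprS invfM.
rewrite !rmorphD !rmorphM /=.
have := exp2_gt0 d; rewrite -invr_gt0; move: (_ ^-1) => u u0 /andP[h1 h2].
by apply/andP; split; nra.
Qed.

Lemma interior_cell_behead (o : octant) (P : node) (y : 'rV[R]_3) :
  interior (@cell R (o :: P)) y -> interior (@cell R P) y.
Proof.
apply: interiorS => {}y yC j; have /andP[y1 y2] := yC j; rewrite mxE in y1 y2.
apply/andP; split; [apply: le_trans y1|apply: le_trans y2 _];
  rewrite le_grid [size (_ :: _)]/= exprS; have := exp2z_gt0 (size P);
  move: (2 ^+ size P) (grid_index P 0 j) => p a ?;
  by case: (o j); rewrite ?mulr1n ?mulr0n; nia.
Qed.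

(** A cell whose interior meets a closed cube of an equal or finer grid contains that cube; mere
    contact of closed cells would not suffice. *)
Lemma vicinityP (A P : node) (y : 'rV[R]_3) : (size A <= size P)%N ->
  interior (@cell R A) y -> vicinity P y ->
  exists k, [/\ covers A (size P) k, k <> grid_index P &
    forall j, k 0 j <= grid_index P 0 j + 1 /\ grid_index P 0 j <= k 0 j + 1].
Proof.
move=> sAP /interior_grid_cube yA [k [/grid_cubes_meetP kP kNP] yk].
exists k; split=> //; last by move=> kE; apply: kNP; rewrite kE.
apply/forallP => j; have /andP[A1 A2] := yA j; have /andP[k1 k2] := yk j.
have := lt_le_trans A1 k2; have := le_lt_trans k1 A2; rewrite !lt_grid.
rewrite -(subnK sAP) exprD.
move: (grid_index A 0 j) (k 0 j) => a b.
move: (exp2z_gt0 (size A)) (exp2z_gt0 (size P - size A)).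
move: (2 ^+ size A) (2 ^+ (size P - size A)) => p q p0 q0.
by rewrite !mulrA !ler_pM2r // !ltr_pM2r // => *; apply/andP; split; lia.
Qed.

Lemma vicinity_touch (A P : node) (y : 'rV[R]_3) : (size A <= size P)%N ->
  interior (@cell R A) y -> vicinity P y -> touch A P.
Proof.
move=> sAP yA yP; have [k [cA _ kP]] := vicinityP sAP yA yP.
apply/forallP => j; move/forallP: cA => /(_ j); have := kP j.
rewrite -(subnK sAP) exprD.
move: (grid_index A 0 j) (grid_index P 0 j) (k 0 j) => a b c.
move: (exp2z_gt0 (size A)) (exp2z_gt0 (size P - size A)).
move: (2 ^+ size A) (2 ^+ (size P - size A)) => p q p0 q0.
by rewrite !mulrA !ler_pM2r // !ltr_pM2r // => *; apply/andP; split; lia.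
Qed.

(** The only cube of its own grid that [P] covers is its own, which the vicinity leaves out. *)
Lemma vicinity_self (P : node) (y : 'rV[R]_3) :
  interior (@cell R P) y -> ~ vicinity P y.
Proof.
by move=> yP /(vicinityP (leqnn _) yP)[k [/covers_eq]].
Qed.

(** The witness is the centre of the cube [k] obtained by clamping the cube of [C] into [A]. This
    cube lies in [A] and touches [C]; it differs from the cube of [C], since otherwise [A] would be
    [C] or an ancestor of it. *)
Lemma touch_vicinity (A C : node) : (size A <= size C)%N ->
  touch A C -> ~~ suffix A C ->
  interior (@cell R A) `&` interior (@vicinity R C) !=set0.
Proof.
move=> sAC tAC nAC; set k := grid_shift (clamp_offset A C) C.
have cA : covers A (size C) k by exact: covers_clamp.
have kNC : k <> grid_index C.
  move=> kC; move/negP: nAC; apply; apply: covers_suffix sAC cA _.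
  by rewrite kC covers_grid_index.
exists (\row_j ((2 * k 0 j + 1)%:~R / 2 ^+ (size C).+1)); split.
  apply: interiorS (@grid_cube_center _ k) => y yk j.
  move/forallP: cA => /(_ j) /andP[A1 A2]; have /andP[k1 k2] := yk j.
  apply/andP; split; first by apply: le_trans k1; rewrite le_grid.
  apply: le_trans k2 _; rewrite le_grid.
  move: A2; rewrite -(subnK sAC) exprD.
  move: (grid_index A 0 j) (k 0 j) => a b.
  move: (exp2z_gt0 (size A)) (exp2z_gt0 (size C - size A)).
  move: (2 ^+ size A) (2 ^+ (size C - size A)) => p q p0 q0.
  by rewrite !mulrA !ler_pM2r // !ltr_pM2r //; lia.
apply: interiorS (@grid_cube_center _ k) => y yk; exists k => //; split.
  apply: grid_cubes_meet => j; rewrite mxE.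
  by have := ltn_ord (clamp_offset A C j); split; lia.
(* The vicinity compares cubes as sets, so equal sets must be shown to have equal indices: the
   centre of a cube determines its index. *)
move=> kC; apply: kNC; apply/rowP => j.
have : @cell R C (\row_j ((2 * k 0 j + 1)%:~R / 2 ^+ (size C).+1)).
  by rewrite -kC; apply: interior_subset; exact: grid_cube_center.
move/(_ j); rewrite mxE !le_grid exprS.
move: (exp2z_gt0 (size C)); move: (2 ^+ size C) (k 0 j) => p a p0.
by move=> /andP[h1 h2]; nia.
Qed.

Lemma separated_not_touch (A C : node) : (size A <= size C)%N ->
  Defs.separated R A C -> ~~ suffix A C -> ~~ touch A C.
Proof.
case: C => // o P sAP [_ nA] AC; apply/negP => tAC.
exact/nA/touch_vicinity.
Qed.

Lemma separated_irrefl (C : node) : ~ Defs.separated R C C.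
Proof.
case: C => // o P [[y [yC yP]] _].
exact: (vicinity_self (interior_cell_behead yC) (interior_subset yP)).
Qed.

Lemma separated_touch_parent (A : node) (o : octant) (P : node) :
  (size A <= size P)%N -> Defs.separated R A (o :: P) -> touch A P.
Proof.
move=> sAP [[y [yA yP]] _].
exact: vicinity_touch sAP yA (interior_subset yP).
Qed.

Lemma separated_touch_parents (o o' : octant) (A P : node) :
  (size A <= size P)%N -> Defs.separated R (o' :: A) (o :: P) -> touch A P.
Proof.
move=> sAP [[y [yA yP]] _].
exact: vicinity_touch sAP (interior_cell_behead yA) (interior_subset yP).
Qed.

End Geometry.

(** * Suffixes of sequences, that is, ancestors of nodes *)

Lemma suffix_cons_inv (T : eqType) (A M : seq T) :
  suffix A M -> A != M -> exists o, suffix (o :: A) M.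
Proof.
move=> /suffixP[s ->]; case/lastP: s => [|s o]; first by rewrite eqxx.
by exists o; rewrite cat_rcons; apply/suffixP; exists s.
Qed.

Lemma suffix_size_eq (T : eqType) (A M : seq T) :
  suffix A M -> size A = size M -> A = M.
Proof.
move=> /suffixP[[|o s] ->] //=; rewrite size_cat => /eqP.
by rewrite eqn_leq andbC ltnNge leq_addl.
Qed.

Lemma suffix_total (T : eqType) (A B M : seq T) :
  suffix A M -> suffix B M -> (size A <= size B)%N -> suffix A B.
Proof.
rewrite !suffixE => /eqP AM /eqP BM sAB.
have sBM : (size B <= size M)%N by rewrite -BM size_drop leq_subr.
by apply/eqP; rewrite -[RHS]AM -[X in drop _ X]BM drop_drop; congr drop; lia.
Qed.

Definition swap_pair (I J : Type) (p : I * J) : J * I := (p.2, p.1).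

Lemma swap_pair_inj (I J : Type) : injective (@swap_pair I J).
Proof. by move=> [? ?] [? ?] [-> ->]. Qed.

(** * Counting leaves and divided nodes of a finite octree *)

Section OctreeCounting.
Variables (R : realType) (t N : nat) (x : 'I_N -> 'rV[R]_3).

Lemma contains_suffix (A M : node) (i : 'I_N) :
  suffix A M -> contains x M i -> contains x A i.
Proof.
by move=> /suffixP[s ->]; elim: s => //= o s IHs /andP[/IHs].
Qed.

Lemma contains_inj (A B : node) (i : 'I_N) :
  size A = size B -> contains x A i -> contains x B i -> A = B.
Proof.
elim: A B => [|o A IHA] [|o' B] //= [sAB].
move=> /andP[cA /forallP oA] /andP[cB /forallP oB].
have AB := IHA _ sAB cA cB; subst B; congr (_ :: _).
by apply/ffunP => j; rewrite (eqP (oA j)) (eqP (oB j)).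
Qed.

(** The nodes containing a given particle form a chain: [B] truncated to the depth of [A] contains
    the particle too, hence is [A]. *)
Lemma contains_comparable (A B : node) (i : 'I_N) :
  (size A <= size B)%N -> contains x A i -> contains x B i -> suffix A B.
Proof.
move=> sAB cA cB.
have sufB : suffix (drop (size B - size A) B) B by apply: suffix_drop.
rewrite (contains_inj _ cA (contains_suffix sufB cB)) //.
by rewrite size_drop subKn.
Qed.

Lemma contains_child (M : node) (i : 'I_N) :
  contains x M i -> exists o, contains x (o :: M) i.
Proof.
move=> cM; exists [ffun j => midplane R M j < x i 0 j] => /=.
by rewrite cM; apply/forallP => j; rewrite ffunE.
Qed.

Lemma is_node_suffix (A M : node) :
  suffix A M -> is_node t x M -> is_node t x A.
Proof.
by move=> /suffixP[s ->]; elim: s => //= o s IHs /and3P[/IHs].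
Qed.

Lemma leaf_suffix (A M : node) :
  leaf t x A -> is_node t x M -> suffix A M -> A = M.
Proof.
move=> /andP[_ lA] nM AM; apply/eqP/negPn/negP => AneM.
have [o /is_node_suffix/(_ nM)] := suffix_cons_inv AM AneM.
by case/and3P=> _; rewrite ltnNge lA.
Qed.

Lemma leaf_contains_inj (A B : node) (i : 'I_N) :
  leaf t x A -> leaf t x B -> contains x A i -> contains x B i -> A = B.
Proof.
move=> lA lB cA cB; have [/andP[nA _] /andP[nB _]] := (lA, lB).
have [sAB|/ltnW sBA] := leqP (size A) (size B).
  exact: leaf_suffix lA nB (contains_comparable sAB cA cB).
exact/esym/(leaf_suffix lB nA)/(contains_comparable sBA cB cA).
Qed.

Definition nb_children (M : node) : nat := #|occupied_children t x M|.

Lemma nb_children_le8 (M : node) : (nb_children M <= 8)%N.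
Proof.
by apply: leq_trans (max_card _) _; rewrite card_ffun card_bool card_ord.
Qed.

Variable T : seq node.
Hypotheses (uniqT : uniq T) (memT : forall M, (M \in T) = is_node t x M).
Hypothesis N_gt0 : (0 < N)%N.

(** At the root this is [N_gt0]; below the root it is part of [is_node]. *)
Lemma is_node_occupied (M : node) : is_node t x M -> occupied x M.
Proof.
case: M => [_|o M /and3P[]] //.
by rewrite /occupied /nb_particles cardT size_enum_ord.
Qed.

Lemma is_node_contains (M : node) :
  is_node t x M -> exists i, contains x M i.
Proof. by move=> /is_node_occupied/card_gt0P[i]; exists i. Qed.

Definition leaves : seq node := [seq M <- T | leaf t x M].
Definition divs : seq node := [seq M <- T | divided t x M].

Lemma mem_leaves (M : node) : (M \in leaves) = leaf t x M.
Proof. by rewrite mem_filter memT andb_idr // => /andP[]. Qed.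

Lemma mem_divs (M : node) : (M \in divs) = divided t x M.
Proof. by rewrite mem_filter memT andb_idr // => /and3P[]. Qed.

Lemma nb_children_undivided (M : node) : is_node t x M ->
  ~~ divided t x M -> (nb_children M <= 1)%N.
Proof.
by move=> nM; rewrite /divided nM is_node_occupied //= -leqNgt.
Qed.

Lemma nb_children_nonleaf (M : node) : is_node t x M ->
  ~~ leaf t x M -> (0 < nb_children M)%N.
Proof.
move=> nM; rewrite /leaf nM /= -ltnNge => tM.
have [i /contains_child[o co]] := is_node_contains nM.
have oo : occupied x (o :: M) by apply/card_gt0P; exists i.
by apply/card_gt0P; exists o; rewrite inE /= nM tM oo.
Qed.

(** Picking one particle in each leaf is injective, as no particle lies in two leaves. *)
Lemma size_leaves : (size leaves <= N)%N.
Proof.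
have -> : N = size (map (@Some 'I_N) (enum 'I_N)).
  by rewrite size_map -cardE card_ord.
have pickT M : leaf t x M ->
    exists2 i, [pick i | contains x M i] = Some i & contains x M i.
  case: pickP => [i ci _|nc /andP[/is_node_contains[i]]]; first by exists i.
  by rewrite nc.
rewrite -(size_map (fun M => [pick i | contains x M i])) uniq_leq_size //.
  rewrite map_inj_in_uniq ?filter_uniq // => A B; rewrite !mem_leaves => lA lB.
  have [i -> ci] := pickT _ lA; have [j -> cj] := pickT _ lB => -[ij].
  by apply: (leaf_contains_inj lA lB ci); rewrite ij.
move=> y /mapP[M]; rewrite mem_leaves => /pickT[i -> _] ->.
by rewrite map_f ?mem_enum.
Qed.

Lemma sum_nb_children : (\sum_(M <- T) nb_children M <= size T)%N.
Proof.
pose s := [seq o :: M | M <- T, o <- enum (occupied_children t x M)].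
have -> : (\sum_(M <- T) nb_children M)%N = size s.
  rewrite size_allpairs_dep sumnE big_map.
  by apply: eq_bigr => M _; rewrite -cardE.
apply: uniq_leq_size.
  apply: allpairs_uniq_dep => // [M _|[M o] [M' o'] _ _ /= [-> ->]] //.
  exact: enum_uniq.
move=> _ /allpairsPdep[M [o [_ oM ->]]].
by rewrite memT; move: oM; rewrite mem_enum inE => /andP[].
Qed.

(** Every node satisfies 1 + [divided] <= [nb_children] + [leaf]. Summing over the tree and
    cancelling [size T] by [sum_nb_children] leaves at most as many divided nodes as leaves. *)
Lemma size_divs : (size divs <= N)%N.
Proof.
apply: leq_trans size_leaves.
rewrite !size_filter -!sum1_count big_mkcond [leqRHS]big_mkcond /=.
rewrite -(leq_add2l (size T)) -sum1_size -big_split /=.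
apply: (@leq_trans (\sum_(M <- T) (nb_children M + leaf t x M))%N); last first.
  by rewrite big_split /= leq_add // sum1_size sum_nb_children.
rewrite big_seq [leqRHS]big_seq; apply: leq_sum => M; rewrite memT => nM.
case: ifPn => [/and3P[_ _ d2]|_]; first by rewrite addn1 ltn_addr.
rewrite addn0; have [//|/(nb_children_nonleaf nM)] := boolP (leaf t x M).
  by rewrite addn1.
by rewrite addn0.
Qed.

(** * Counting pairs of touching and of nearly touching nodes *)

Definition pairs (P : rel node) : seq (node * node) :=
  [seq p <- [seq (A, B) | A <- T, B <- T] | P p.1 p.2].

Lemma uniq_pairs (P : rel node) : uniq (pairs P).
Proof.
by rewrite filter_uniq // allpairs_uniq // => -[? ?] [? ?] _ _ [-> ->].
Qed.

Lemma mem_pairs (P : rel node) (A B : node) :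
  ((A, B) \in pairs P) = [&& P A B, is_node t x A & is_node t x B].
Proof.
rewrite mem_filter -!memT; congr (_ && _).
apply/allpairsP/andP => [[[C D] [/= CT DT [-> ->]]]//|[AT BT]].
by exists (A, B).
Qed.

Lemma pairsP (P : rel node) (p : node * node) :
  reflect [/\ P p.1 p.2, is_node t x p.1 & is_node t x p.2] (p \in pairs P).
Proof. by case: p => A B; rewrite mem_pairs; apply: and3P. Qed.

(** For a fixed second node, the first nodes form an antichain of touching nodes that are not
    deeper, so there are at most 27. *)
Lemma size_near_snd (s : seq (node * node)) (D : seq node) : uniq s ->
  {in s, forall p, [&& p.2 \in D, (size p.1 <= size p.2)%N & touch p.1 p.2]} ->
  {in s &, forall p q, p.2 = q.2 -> suffix p.1 q.1 -> p.1 = q.1} ->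
  (size s <= 27 * size D)%N.
Proof.
move=> us sP santi.
apply: (@size_le_mul_fibers _ _ snd) => [p /sP/and3P[]//|B _].
rewrite -size_filter -(size_map fst); apply: (@size_touching_antichain B).
- rewrite map_inj_in_uniq ?filter_uniq // => -[A C] [A' C'].
  by rewrite !mem_filter /= => /andP[/eqP-> _] /andP[/eqP-> _] ->.
- move=> _ /mapP[[A C] + ->]; rewrite mem_filter => /andP[/eqP/= <- /sP].
  by case/and3P=> _ -> ->.
- move=> _ _ /mapP[p + ->] /mapP[q + ->]; rewrite !mem_filter.
  move=> /andP[/eqP pB ps] /andP[/eqP qB qs]; apply: santi => //.
  by rewrite pB.
Qed.

Lemma size_near_fst (s : seq (node * node)) (D : seq node) : uniq s ->
  {in s, forall p, [&& p.1 \in D, (size p.2 <= size p.1)%N & touch p.1 p.2]} ->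
  {in s &, forall p q, p.1 = q.1 -> suffix p.2 q.2 -> p.2 = q.2} ->
  (size s <= 27 * size D)%N.
Proof.
move=> us sP santi.
rewrite -(size_map (@swap_pair node node)); apply: size_near_snd.
- by rewrite (map_inj_uniq (@swap_pair_inj _ _)).
- by move=> _ /mapP[p /sP/and3P[h1 h2 h3] ->] /=; rewrite h1 h2 touch_sym h3.
- by move=> _ _ /mapP[p ps ->] /mapP[q qs ->]; apply: santi.
Qed.

(* Every V-list pair, and every W-list pair of equal depth, is of this kind. *)
Definition far_siblings : seq (node * node) :=
  pairs (fun A B => [&& size A == size B, A != [::],
                        touch (behead A) (behead B) & ~~ touch A B]).

Lemma is_node_child (o : octant) (M : node) :
  is_node t x (o :: M) -> o \in enum (occupied_children t x M).
Proof. by move=> nM; rewrite mem_enum inE nM is_node_occupied. Qed.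

(** Nodes of equal depth form an antichain, so each of the at most N divided nodes occurs at most 27
    times on either side. *)
Lemma size_same_depth (E : seq (node * node)) : uniq E ->
  {in E, forall p, size p.1 = size p.2 /\ touch p.1 p.2} ->
  (count (fun p => divided t x p.1) E <= 27 * N)%N /\
  (count (fun p => divided t x p.2) E <= 27 * N)%N.
Proof.
move=> uE EP; rewrite -!size_filter.
split; apply: (@leq_trans (27 * size divs)); rewrite ?leq_mul ?size_divs //.
  apply: size_near_fst; rewrite ?filter_uniq //.
    move=> p; rewrite mem_filter mem_divs => /andP[-> /EP[-> ->]].
    by rewrite leqnn.
  move=> p q; rewrite !mem_filter => /andP[_ /EP[sp _]] /andP[_ /EP[sq _]] pq.
  by move=> /suffix_size_eq; apply; rewrite -sp -sq pq.
apply: size_near_snd; rewrite ?filter_uniq //.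
  move=> p; rewrite mem_filter mem_divs => /andP[-> /EP[-> ->]].
  by rewrite leqnn.
move=> p q; rewrite !mem_filter => /andP[_ /EP[sp _]] /andP[_ /EP[sq _]] pq.
by move=> /suffix_size_eq; apply; rewrite sp sq pq.
Qed.

(** In [size_boundary] the only root is the pair of roots, [E1] holds the other touching pairs of
    equal depth, and the parent map acts on both components. The constant is 3403 = 1 + 63 * (27 +
    27), the 1 being absorbed by N >= 1. *)
Lemma size_far_siblings : (size far_siblings <= 3403 * N)%N.
Proof.
pose E1 := pairs (fun A B => [&& size A == size B, A != [::] & touch A B]).
pose E0 : seq (node * node) := [:: ([::], [::])].
pose E := E0 ++ E1.
have uE : uniq E by rewrite /= uniq_pairs mem_pairs.
have EP : {in E, forall p, [/\ size p.1 = size p.2, touch p.1 p.2,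
    is_node t x p.1 & is_node t x p.2]}.
  move=> p; rewrite in_cons => /orP[/eqP-> /=|/pairsP[/and3P[/eqP]]] //.
  by split=> //; apply/forallP => j; rewrite mxE.
have [d1 d2] : (count (fun p => divided t x p.1) E <= 27 * N)%N /\
               (count (fun p => divided t x p.2) E <= 27 * N)%N.
  by apply: size_same_depth => // p /EP[].
(* A pair has at most 8 * 8 = 64 child pairs, and at most one if neither node is divided; hence the
   excess 63. *)
pose w (p : node * node) := (63 * (divided t x p.1 + divided t x p.2))%N.
have inE : {in far_siblings ++ E1, forall p, [/\ size p.1 = size p.2,
    p.1 != [::], touch (behead p.1) (behead p.2),
    is_node t x p.1 & is_node t x p.2]}.
  move=> p; rewrite mem_cat => /orP[|] /pairsP[].
    by move=> /and4P[/eqP].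
  case: p => -[|o A] [|o' B] //= /andP[/eqP AB tAB]; split=> //.
  move: tAB; rewrite touch_sym => /touch_behead.
  by rewrite touch_sym => /touch_behead.
have := @size_boundary _ (fun p => (behead p.1, behead p.2)) w E0 E1
  far_siblings.
rewrite -/E => bnd.
apply: leq_trans (bnd _ _) _.
- move=> p /inE [sp p0 tp n1 n2]; case: p sp p0 tp n1 n2 => -[|o A] [|o' B] //=.
  move=> [AB] _ tAB /and3P[nA _ _] /and3P[nB _ _].
  rewrite mem_cat mem_pairs nA nB tAB AB eqxx /=.
  by case: A AB {tAB nA} => //=; case: B {nB}.
- move=> [A B] /EP /= [AB _ nA nB].
  set f := fun _ => _; pose c := enum (occupied_children t x A).
  pose c' := enum (occupied_children t x B).
  rewrite -size_filter.
  apply: (@leq_trans (size [seq (o :: A, o' :: B) | o <- c, o' <- c'])).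
    apply: uniq_leq_size.
      rewrite filter_uniq // cat_uniq !uniq_pairs /= andbT.
      (* Pairs in [E1] touch and those in [far_siblings] do not, so the concatenation has no
         repetition. *)
      apply/hasPn => -[C D] /pairsP[/and3P[_ _ tCD] _ _].
      by rewrite mem_pairs tCD /= !andbF.
    move=> [C D]; rewrite mem_filter => /andP[/eqP[CA DB] /inE[/=]].
    case: C CA => [|o C] //=; case: D DB => [|o' D] //= -> -> _ _ _ nC nD.
    by apply: allpairs_f; apply: is_node_child.
  rewrite size_allpairs -!cardE -!/(nb_children _) /w /=.
  have [_|nA1] := boolP (divided t x A).
    have := nb_children_le8 A; have := nb_children_le8 B; nia.
  have := nb_children_undivided nA nA1.
  have [_|nB1] := boolP (divided t x B).
    have := nb_children_le8 B; nia.
  have := nb_children_undivided nB nB1; nia.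
rewrite /w -big_distrr /= big_split /=.
rewrite (sum_pred_count (fun p => divided t x p.1)).
rewrite (sum_pred_count (fun p => divided t x p.2)).
apply: (@leq_trans (1 + 63 * (27 * N + 27 * N))); last lia.
by rewrite leq_add2l leq_mul2l leq_add.
Qed.

(* The W-list pairs of different depths are of this kind. *)
Definition leaf_boundary : seq (node * node) :=
  pairs (fun C B => [&& leaf t x C, (size C < size B)%N,
                        touch C (behead B) & ~~ touch C B]).

(** No node lies strictly below a leaf, so the leaves paired with a given node form an antichain
    even though their depths vary. *)
Lemma size_leaf_near (E : seq (node * node)) (D : seq node) : uniq E ->
  {in E, forall p, [/\ leaf t x p.1, is_node t x p.1, p.2 \in D,
                       (size p.1 <= size p.2)%N & touch p.1 p.2]} ->
  (size E <= 27 * size D)%N.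
Proof.
move=> uE EP; apply: size_near_snd => // [p /EP[_ _ -> -> ->]//|].
move=> p q /EP[lp _ _ _ _] /EP[_ nq _ _ _] _; exact: leaf_suffix.
Qed.

(** The parent map now fixes the leaf and climbs only in the second component. The forest roots are
    the touching pairs of equal depth, at most 27 per leaf, and 216 = 27 + 7 * 27. *)
Lemma size_leaf_boundary : (size leaf_boundary <= 216 * N)%N.
Proof.
pose E0 := pairs (fun C B => [&& leaf t x C, size C == size B & touch C B]).
pose E1 := pairs (fun C B => [&& leaf t x C, (size C < size B)%N & touch C B]).
pose E := E0 ++ E1.
have uE : uniq E.
  rewrite cat_uniq !uniq_pairs /= andbT; apply/hasPn => -[C D].
  move=> /pairsP[/and3P[/= _ CD _] _ _].
  by rewrite mem_pairs (ltn_eqF CD) /= andbF.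
have EP : {in E, forall p, [/\ leaf t x p.1, (size p.1 <= size p.2)%N,
    touch p.1 p.2, is_node t x p.1 & is_node t x p.2]}.
  move=> p; rewrite mem_cat.
  move=> /orP[|] /pairsP[/and3P[lp sp tp] n1 n2]; split=> //.
    by rewrite (eqP sp).
  exact: ltnW.
(* Only the second component branches, into at most 8 children; hence the excess 7. *)
pose w (p : node * node) := (7 * divided t x p.2)%N.
have inE : {in leaf_boundary ++ E1, forall p, [/\ leaf t x p.1,
    (size p.1 < size p.2)%N, touch p.1 (behead p.2),
    is_node t x p.1 & is_node t x p.2]}.
  move=> p; rewrite mem_cat => /orP[|] /pairsP[].
    by move=> /and4P[].
  case: p => A B /= /and3P[lA sAB tAB] nA nB; split=> //.
  by case: B tAB {sAB nB} => // o B /touch_behead.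
have := @size_boundary _ (fun p => (p.1, behead p.2)) w E0 E1 leaf_boundary.
rewrite -/E => bnd.
apply: leq_trans (bnd _ _) _.
- move=> p /inE [lp sp tp n1 n2]; case: p lp sp tp n1 n2 => C [|o B] //=.
  rewrite ltnS => lC sCB tCB nC /and3P[nB _ _].
  by rewrite mem_cat !mem_pairs lC nC nB tCB /= !andbT -leq_eqVlt.
- move=> [C B] /EP /= [_ _ _ nC nB].
  set f := fun _ => _; pose c := enum (occupied_children t x B).
  rewrite -size_filter; apply: (@leq_trans (size [seq (C, o :: B) | o <- c])).
    apply: uniq_leq_size.
      rewrite filter_uniq // cat_uniq !uniq_pairs /= andbT.
      apply/hasPn => -[C' D] /pairsP[/and3P[_ _ tCD] _ _].
      by rewrite mem_pairs tCD /= !andbF.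
    move=> [C' D]; rewrite mem_filter => /andP[/eqP[CC DB] /inE[/=]].
    case: D DB => [|o' D] //= -> _ _ _ _ nD; rewrite CC.
    by apply: map_f; apply: is_node_child.
  rewrite size_map -cardE -/(nb_children _) /w /=.
  have [_|nB1] := boolP (divided t x B); first exact: nb_children_le8.
  exact: nb_children_undivided.
have d2 : (count (fun p => divided t x p.2) E <= 27 * N)%N.
  rewrite -size_filter.
  apply: (@leq_trans (27 * size divs)); rewrite ?leq_mul ?size_divs //.
  apply: size_leaf_near; rewrite ?filter_uniq // => p.
  by rewrite mem_filter mem_divs => /andP[-> /EP[]].
have E0N : (size E0 <= 27 * N)%N.
  apply: (@leq_trans (27 * size leaves)); rewrite ?leq_mul ?size_leaves //.
  apply: size_near_fst; rewrite ?uniq_pairs //.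
    move=> p /pairsP[/and3P[lp /eqP sp tp] _ _].
    by rewrite mem_leaves lp tp sp leqnn.
  move=> p q /pairsP[/and3P[_ /eqP sp _] _ _].
  move=> /pairsP[/and3P[_ /eqP sq _] _ _] pq.
  by move=> /suffix_size_eq; apply; rewrite -sp -sq pq.
rewrite /w -big_distrr /=.
rewrite (sum_pred_count (fun p => divided t x p.2)).
by rewrite (_ : 216 = 27 + 7 * 27)%N // mulnDl -mulnA leq_add // leq_mul.
Qed.

(** At equal depth an ancestor would be the node itself, which is not separated from itself, so
    separation does exclude touching. *)
Lemma touch_parents_far (A C : node) : is_node t x A -> is_node t x C ->
  size A = size C -> Defs.separated R A C -> (A, C) \in far_siblings.
Proof.
case: C => [|o P] nA nC sAC sepAC //.
case: A sAC nA sepAC => // o' A [sAP] nA sepAC.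
have AC : ~~ suffix (o' :: A) (o :: P).
  apply/negP => /suffix_size_eq /= AC; move: sepAC.
  by rewrite AC ?sAP // => /separated_irrefl.
rewrite mem_pairs nA nC /= sAP eqxx (separated_touch_parents _ sepAC) ?sAP //=.
by rewrite andbT; apply: separated_not_touch sepAC AC; rewrite /= sAP.
Qed.

(** * Number of operations of each kind *)

Definition op_pairs (f : node -> node -> operation N) : seq (node * node) :=
  pairs (fun A B => `[< performed t x (f A B) >]).

(** Well-separation in both directions forces equal depths. *)
Lemma size_M2L : (size (op_pairs (@M2L N)) <= 3403 * N)%N.
Proof.
apply: leq_trans size_far_siblings; rewrite -(size_map (@swap_pair node node)).
apply: uniq_leq_size.
  by rewrite (map_inj_uniq (@swap_pair_inj _ _)) uniq_pairs.
move=> q /mapP[[C A] /pairsP[/asboolP/= [_ _ [sepAC sAC] [_ sCA]] nC nA] -> /=].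
by apply: touch_parents_far => //; apply/eqP; rewrite eqn_leq sAC.
Qed.

(** A W-list pair of equal depth is in [far_siblings]. Otherwise [A] is deeper, its parent touches
    the leaf [C], and [C] is not an ancestor of [A], so the pair is in [leaf_boundary]. *)
Lemma size_M2P : (size (op_pairs (@M2P N)) <= 3619 * N)%N.
Proof.
apply: (@leq_trans (size (far_siblings ++ leaf_boundary))); last first.
  have -> : (3619 = 3403 + 216)%N by [].
  by rewrite size_cat mulnDl leq_add ?size_far_siblings ?size_leaf_boundary.
apply: uniq_leq_size; first exact: uniq_pairs.
move=> [C A] /pairsP[/asboolP/= [lC nA [sepCA sCA] _] nC _].
rewrite mem_cat; apply/orP; move: sCA; rewrite leq_eqVlt => /orP[/eqP sCA|sCA].
  by left; apply: touch_parents_far.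
right; rewrite mem_pairs nC nA lC sCA /= !andbT.
have CA : ~~ suffix C A.
  by apply/negP => /(leaf_suffix lC nA) CA; rewrite CA ltnn in sCA.
rewrite (separated_not_touch (ltnW sCA) sepCA CA) andbT.
case: A sCA sepCA {nA CA} => // o A sCA; exact: separated_touch_parent.
Qed.

Lemma size_P2L : (size (op_pairs (@P2L N)) <= 3619 * N)%N.
Proof.
apply: leq_trans size_M2P; rewrite -(size_map (@swap_pair node node)).
apply: uniq_leq_size.
  by rewrite (map_inj_uniq (@swap_pair_inj _ _)) uniq_pairs.
move=> q /mapP[[C A] /pairsP[/asboolP/= [_ wAC] nC nA] ->].
by rewrite mem_pairs nC nA !andbT; apply/asboolP.
Qed.

Lemma size_leaves_divs : (size (leaves ++ divs) <= 2 * N)%N.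
Proof. by rewrite size_cat mul2n -addnn leq_add ?size_leaves ?size_divs. Qed.

(** A pair is determined by its first node: two divided parents have the same depth by maximality
    and are suffixes of the same node. *)
Lemma size_M2M : (size (op_pairs (@M2M N)) <= 2 * N)%N.
Proof.
apply: leq_trans size_leaves_divs; rewrite -(size_map fst).
apply: uniq_leq_size.
  rewrite map_inj_in_uniq ?uniq_pairs // => -[C D] [C' D'].
  move=> /pairsP[/asboolP/= [_ _ _ _ [DC dD maxD]] _ _].
  move=> /pairsP[/asboolP/= [_ _ _ _ [DC' dD' maxD']] _ _] CC'; subst C'.
  have sDD : size D = size D' by apply/eqP; rewrite eqn_leq maxD ?maxD'.
  move: DC DC' => /andP[sDC _] /andP[sDC' _].
  by rewrite (suffix_size_eq (suffix_total sDC sDC' _)) ?sDD.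
move=> C /mapP[[C' D] /pairsP[/asboolP/= [nC _ oC sC _] _ _] ->] /=.
(* A node that is not a leaf has a child; if it is not a singleton either, it has two and is
   divided. *)
rewrite mem_cat mem_leaves mem_divs; have [//|lC /=] := boolP (leaf t x C').
have := nb_children_nonleaf nC lC; move: sC.
by rewrite /singleton /divided nC oC /= /nb_children => /eqP; lia.
Qed.

(** A pair is determined by its child [B]: of two distinct divided proper ancestors of [B], the
    deeper would lie strictly between the shallower and [B]. *)
Lemma size_L2L : (size (op_pairs (@L2L N)) <= 2 * N)%N.
Proof.
apply: leq_trans size_leaves_divs; rewrite -(size_map snd).
apply: uniq_leq_size.
  rewrite map_inj_in_uniq ?uniq_pairs // => -[D B] [D' B'].
  move=> /pairsP[/asboolP/= [dD DB _ betw] _ _].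
  move=> /pairsP[/asboolP/= [dD' DB' _ betw'] _ _] BB'; subst B'.
  have unique E E' : divided t x E' -> proper_ancestor E B ->
      proper_ancestor E' B -> (size E <= size E')%N ->
      (forall F, proper_ancestor E F -> proper_ancestor F B ->
         ~~ divided t x F) ->
      E = E'.
    move=> dE' EB E'B sE bE; apply/eqP/negPn/negP => EE'.
    have sufEE' : suffix E E'.
      by case/andP: EB E'B => EB _ /andP[E'B _]; exact: suffix_total EB E'B sE.
    have pEE' : proper_ancestor E E' by rewrite /proper_ancestor sufEE'.
    by have := bE _ pEE' E'B; rewrite dE'.
  have [sDD|/ltnW sDD] := leqP (size D) (size D').
    by rewrite (unique D D').
  by rewrite (unique D' D).
move=> B /mapP[[D B'] /pairsP[/asboolP/= [_ _ + _] _ _] ->] /=.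
by rewrite mem_cat mem_leaves mem_divs => /orP[->|/andP[->]//]; rewrite orbT.
Qed.

Definition near_leaves : seq (node * node) :=
  pairs (fun C A => `[< U_list t x C A >]).

(** Each pair is charged to its deeper leaf, which touches at most 27 leaves that are not deeper;
    the two possible orders of depth give 54. *)
Lemma size_near_leaves : (size near_leaves <= 54 * N)%N.
Proof.
pose le_depth (p : node * node) := (size p.1 <= size p.2)%N.
rewrite -(count_predC le_depth) -!size_filter.
have -> : (54 = 27 + 27)%N by [].
rewrite mulnDl leq_add //; apply: (@leq_trans (27 * size leaves));
  rewrite ?leq_mul ?size_leaves //.
  apply: size_leaf_near => [|[C A]]; first exact/filter_uniq/uniq_pairs.
  rewrite mem_filter => /andP[/= CA /pairsP[/asboolP/= [lC lA tAC] nC nA]].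
  by rewrite mem_leaves touch_sym (adjacent_touch tAC).
rewrite -(size_map (@swap_pair node node)); apply: size_leaf_near.
  rewrite (map_inj_uniq (@swap_pair_inj _ _)).
  exact/filter_uniq/uniq_pairs.
move=> q /mapP[[C A] + ->]; rewrite mem_filter /le_depth /= -ltnNge.
move=> /andP[/ltnW CA /pairsP[/asboolP/= [lC lA tAC] nC nA]].
by rewrite mem_leaves (adjacent_touch tAC).
Qed.

Definition P2P_ops : seq (operation N) :=
  flatten [seq [seq P2P i j | i <- enum (contains x p.1),
                              j <- enum (contains x p.2)] | p <- near_leaves].

Lemma size_P2P : (size P2P_ops <= t * t * (54 * N))%N.
Proof.
apply: (@leq_trans (t * t * size near_leaves)); last first.
  by rewrite leq_mul ?size_near_leaves.
rewrite size_flatten /shape -map_comp sumnE big_map mulnC.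
rewrite -[leqRHS](_ : \sum_(p <- near_leaves) (t * t) = _)%N; last first.
  by rewrite big_const_seq count_predT iter_addn_0 mulnC.
rewrite big_seq [leqRHS]big_seq; apply: leq_sum => -[C A].
move=> /pairsP[/asboolP/= [/andP[_ lC] /andP[_ lA] _] _ _].
by rewrite size_allpairs -!cardE leq_mul.
Qed.

(** P2M, L2P, M2M and L2L contribute (1 + 1 + 2 + 2) N = 6 N together, M2P and P2L 3619 N each. *)
Lemma size_performed (s : seq (operation N)) : uniq s ->
  {in s, forall op, performed t x op} ->
  (size s <= (6 + 3403 + 2 * 3619 + 54 * t * t) * N)%N.
Proof.
move=> us sP.
pose un (f : node -> node -> operation N) (p : node * node) := f p.1 p.2.
pose ops f := map (un f) (op_pairs f).
have opsP f A B : performed t x (f A B) -> is_node t x A -> is_node t x B ->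
    f A B \in ops f.
  move=> fAB nA nB; apply/mapP; exists (A, B) => //.
  by rewrite mem_pairs nA nB !andbT; apply/asboolP.
pose L := map (@P2M N) (enum 'I_N) ++ map (@L2P N) (enum 'I_N) ++
  ops (@M2M N) ++ ops (@L2L N) ++ ops (@M2L N) ++ ops (@M2P N) ++
  ops (@P2L N) ++ P2P_ops.
have divN M : divided t x M -> is_node t x M by case/and3P.
have leafN M : leaf t x M -> is_node t x M by case/andP.
apply: (@leq_trans (size L)).
  apply: uniq_leq_size => // op /sP; rewrite !mem_cat.
  case: op => [i|i|C D|D C|C A|C A|C A|i j] op_performed.
  - by rewrite map_f ?mem_enum.
  - by rewrite [X in _ || (X || _)]map_f ?mem_enum ?orbT.
  - case: (op_performed) => nC _ _ _ [aDC _ _].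
    by rewrite (opsP (@M2M N)) ?(proper_ancestor_node aDC nC) ?orbT.
  - case: (op_performed) => /divN nD _ /orP[/divN nC|/andP[/leafN nC _]] _;
    by rewrite (opsP (@L2L N)) ?orbT.
  - by case: (op_performed) => nC nA _ _; rewrite (opsP (@M2L N)) ?orbT.
  - by case: (op_performed) => /leafN nC nA _ _; rewrite (opsP (@M2P N)) ?orbT.
  - case: (op_performed) => nC [/leafN nA _ _ _].
    by rewrite (opsP (@P2L N)) ?orbT.
  - case: op_performed => C [A [lC Ci CA Aj]].
    do 7 (apply/orP; right); apply/flatten_mapP; exists (C, A).
      case: (CA) => _ lA _.
      by rewrite mem_pairs !leafN // !andbT; apply/asboolP.
    by apply: allpairs_f; rewrite mem_enum.
rewrite !size_cat !size_map -enumT size_enum_ord.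
have := size_M2M; have := size_L2L; have := size_M2L; have := size_M2P.
have := size_P2L; have := size_P2P; lia.
Qed.

End OctreeCounting.

Theorem mainTheorem1 (R : realType) (t : nat) (kappa : R) (ht : (1 <= t)%N)
    (hkappa : 0 < kappa) :
  exists c : R,
    forall (N : nat) (x : 'I_N -> 'rV[R]_3) (cost : operation N -> R),
      (1 <= N)%N ->
      (forall i j, 0 <= x i 0 j <= 1) ->
      finite_set (octree t x) ->
      (forall op, performed t x op -> cost op <= kappa) ->
      total_cost t x cost <= c * N%:R.
Proof.
exists (kappa * (6 + 3403 + 2 * 3619 + 54 * t * t)%:R).
move=> N x cost N1 _ finT cost_le.
(* Listing the tree and the operations without repetition turns the finitely supported sum into a
   sum over a sequence. *)
have [T0 T0E] := (finite_seqP _).1 finT.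
have [s0 s0E] := (finite_seqP _).1 (finite_performed finT).
pose T := undup T0; pose s := undup s0.
have memT M : (M \in T) = is_node t x M.
  by rewrite mem_undup; apply/idP/idP; rewrite -/([set` T0] M) -T0E.
have sE : performed t x = [set` s].
  by rewrite s0E; apply/seteqP; split=> op /=; rewrite mem_undup.
rewrite /total_cost sE -fsbig_seq ?undup_uniq //.
apply: (@le_trans _ _ (kappa * (size s)%:R)).
  rewrite mulr_natr -count_predT -iter_addr_0 -big_const_seq.
  rewrite big_seq [leRHS]big_seq.
  by apply: ler_sum => op ops; apply: cost_le; rewrite sE.
rewrite -mulrA -natrM ler_pM2l // ler_nat.
apply: (@size_performed R t N x T) => //; rewrite ?undup_uniq //.
by move=> op ops; rewrite sE.
Qed.
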